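(* Let $S$ be a finite set and $n\ge1$. Every mapping $E$ on $S^n$ can be computed by an in situ program of length $5n-4$ and signature $1,\dots,n,n-1,\dots,1,2,\dots,n,n-1,\dots,1,2,\dots,n$. More precisely, for any $P$-factorisation $(F,I,G)$ of $E$ in which the partition-sequence $P$ has no empty member, concatenating an in situ program of $G$ with signature $1,\dots,n,\dots,1$, an in situ program of $I$ with signature $1,\dots,n$, and an in situ program of $F$ with signature $n,\dots,1,\dots,n$ (such programs exist), and then merging each pair of consecutive assignments acting on the same component into one, yields such a program. Equivalently in network terms: the multistage interconnection network $B^{-1}|B|B^{-1}|B|B^{-1}$ has a routing performing $E$, and $B|B^{-1}|B|B^{-1}|B$ has a multicast routing performing $E^{-1}$.
   Context: Identify $S$ with $\{0,\dots,s-1\}$, $s=|S|$. An in situ program of a mapping $E:S^n\to S^n$ is a finite sequence $(\psi_1,i_1),\dots,(\psi_m,i_m)$ with $\psi_k:S^n\to S$, $i_k\in\{1,\dots,n\}$, such that for every $X\in S^n$, setting $X_0=X$ and letting $X_k$ equal $X_{k-1}$ except that its $i_k$-th component is replaced by $\psi_k(X_{k-1})$, one has $X_m=E(X)$; its length is $m$ and its signature is $i_1,\dots,i_m$. The index of $(x_1,\dots,x_n)$ is $x_1+sx_2+\dots+s^{n-1}x_n$, and $X_i$ is the vector of index $i$. A partition-sequence of $S^n$ is a sequence $P=(P_0,\dots,P_k)$ of subsets of $S^n$ whose non-empty members form a partition of $S^n$; $I_P$ is the mapping sending $X_0,\dots,X_{s^n-1}$ in order to $|P_0|$ copies of $X_0$,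 then $|P_1|$ copies of $X_1$, ..., then $|P_k|$ copies of $X_k$. If each non-empty $P_i$ equals $E^{-1}(y_i)$ for some $y_i\in S^n$, a $P$-factorisation of $E$ is a triple $(F,I,G)$ with $I=I_P$, $G$ a bijection of $S^n$ mapping $P_i$ onto $I^{-1}(X_i)$ for each $i$, and $F$ a bijection of $S^n$ mapping $X_i$ to $y_i$ whenever $P_i\neq\emptyset$; then $E=F\circ I\circ G$. Networks: a multistage interconnection network (MIN) is a directed graph whose vertex set consists of stages $S_1^n,\dots,S_k^n$ (copies of $S^n$) with edges only from $S^n_i$ to $S^n_{i+1}$. The assignment network $A_i$ has two stages with edges from $(x_1,\dots,x_n)$ to $(x_1,\dots,x_{i-1},e,x_{i+1},\dots,x_n)$ for every $e\in S$. $M|M'$ denotes concatenation (identifying the last stage of $M$ with the first of $M'$). $B=A_n|\dots|A_1$ and $B^{-1}=A_1|\dots|A_n$. A routing chooses one outgoing edge at each vertex of every non-final stage; it performs $E$ if for each $X$ in the first stage the path of chosen edges from $X$ ends at $E(X)$. A multicast routing performing $E^{-1}$ is a choice of edges such that each vertex of every non-initial stage has exactly one chosen incoming edge and, for each $Y$ in the first stage, the set of final-stage vertices reachable from $Y$ along chosen edges is exactly $E^{-1}(Y)$. *)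

(* Defs.v *)
From mathcomp Require Import all_boot.

Set Implicit Arguments.
Unset Strict Implicit.
Unset Printing Implicit Defensive.

(* S = {0, ..., s-1} is 'I_s and S^n is the type of finite functions
   'I_n -> 'I_s; component number i of the informal text (1 <= i <= n) is the
   one with index i-1 in 'I_n. *)
Definition vec (s n : nat) : finType := {ffun 'I_n -> 'I_s}.

Section InSitu.
Variables (s n : nat).
Local Notation V := (vec s n).

Definition upd (X : V) (i : 'I_n) (e : 'I_s) : V :=
  [ffun j => if j == i then e else X j].

Definition assignment : Type := (V -> 'I_s) * 'I_n.

Definition exec (X : V) (a : assignment) : V := upd X a.2 (a.1 X).

Definition in_situ_program (p : seq assignment) (E : V -> V) : Prop :=
  forall X, foldl exec X p = E X.

(* Signatures are lists of numbers in {1, ..., n}, hence the shift. *)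
Definition signature (p : seq assignment) : seq nat :=
  [seq (nat_of_ord a.2).+1 | a <- p].

(* (psi, i) followed by (psi', i) is the single assignment
   x_i := psi' (X with x_i := psi X). *)
Definition merge2 (a b : assignment) : assignment :=
  (fun X => b.1 (exec X a), a.2).

(* All maximal runs of assignments on one component are collapsed; runs of
   length 3 do occur when n = 1. *)
Fixpoint merge_program (p : seq assignment) : seq assignment :=
  if p is a :: p' then
    let q := merge_program p' in
    if q is b :: q' then
      if a.2 == b.2 then merge2 a b :: q' else a :: q
    else [:: a]
  else [::].

Definition vindex (X : V) : nat := \sum_(j < n) s ^ j * X j.

(* The vector X_i of index i; None when i >= s ^ n. *)
Definition vec_at (i : nat) : option V := [pick X | vindex X == i].

(* The non-empty members are pairwise disjoint as an indexed family: a
   non-empty set is not allowed to occur twice. *)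
Definition partition_sequence (k : nat) (P : k.+1.-tuple {set V}) : Prop :=
  uniq [seq A <- P | A != set0] /\
  partition [set A in P | A != set0] [set: V].

(* The default value X of odflt is reached for no X when P is a
   partition-sequence with k < s ^ n. *)
Definition I_of (k : nat) (P : k.+1.-tuple {set V}) (X : V) : V :=
  odflt X
    (nth None
       (flatten [seq nseq #|tnth P i| (vec_at i) | i <- enum 'I_k.+1])
       (vindex X)).

Definition factorisation (k : nat) (P : k.+1.-tuple {set V})
    (E F I G : V -> V) : Prop :=
  [/\ partition_sequence P,
      I =1 I_of P,
      bijective G /\
        (forall i : 'I_k.+1,
           G @: tnth P i = [set X | Some (I X) == vec_at i])
    & bijective F /\
        (forall i : 'I_k.+1, tnth P i != set0 ->
           exists2 y : V, tnth P i = [set X | E X == y]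
                        & omap F (vec_at i) = Some y)].

(* A network with stages 0, ..., k is the list of its k edge relations, the
   t-th one relating stage t to stage t+1; concatenation M|M' is then ++. *)
Definition network : Type := seq (rel V).

Definition edge (M : network) (t : nat) (X Y : V) : bool :=
  nth (fun _ _ => false) M t X Y.

Definition A_net (i : 'I_n) : network :=
  [:: fun X Y => [exists e : 'I_s, Y == upd X i e]].

Definition B_inv : network := flatten [seq A_net i | i <- enum 'I_n].
Definition B : network := flatten [seq A_net i | i <- rev (enum 'I_n)].

(* A choice of edges of M is a network C with the same stages. *)
Definition subnetwork (C M : network) : Prop :=
  size C = size M /\ forall t X Y, edge C t X Y -> edge M t X Y.

(* reach C X Y: C has a path from X in the first stage to Y in the last. *)
Fixpoint reach (C : network) (X Y : V) : bool :=
  if C is e :: C' then [exists Z, e X Z && reach C' Z Y] else X == Y.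

Definition routing_performing (M C : network) (E : V -> V) : Prop :=
  [/\ subnetwork C M,
      forall t X, t < size C -> exists! Y, edge C t X Y
    & forall X, reach C X (E X)].

Definition multicast_performing_inverse (M C : network) (E : V -> V) : Prop :=
  [/\ subnetwork C M,
      forall t Y, t < size C -> exists! X, edge C t X Y
    & forall Y, [set X | reach C Y X] = [set X | E X == Y]].

End InSitu.

Arguments B_inv : clear implicits.
Arguments B : clear implicits.

(* up a b = a, a+1, ..., b and down b a = b, b-1, ..., a; empty if b < a. *)
Definition up (a b : nat) : seq nat := iota a (b.+1 - a).
Definition down (b a : nat) : seq nat := rev (up a b).

Definition signature_E (n : nat) : seq nat :=
  up 1 n ++ down n.-1 1 ++ up 2 n ++ down n.-1 1 ++ up 2 n.
Definition signature_G (n : nat) : seq nat := up 1 n ++ down n.-1 1.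
Definition signature_I (n : nat) : seq nat := up 1 n.
Definition signature_F (n : nat) : seq nat := down n 1 ++ up 2 n.

(* Main.v *)
Require Import Defs.
From mathcomp Require Import all_boot zify.

(** A map [E] of [S^n] factors as [F \o I \o G], where [G] lists [S^n] fibre
    of [E] by fibre, [I] sends the [i]-th fibre to the vector of index [i], and
    [F] sends that vector to the value of [E] on the fibre.  In terms of
    indices, [I] is nondecreasing and 1-Lipschitz; this is what makes
    the components of [I X] computable in the order [1, ..., n], each one
    overwriting the corresponding component of [X].  The bijections [F] and [G]
    are handled as in the rearrangeability of Benes networks: by Konig's
    theorem the bipartite multigraph whose edges join [X] and [G X], both with
    one component erased, is [s]-edge-colourable; writing the colour of [X] in
    the erased component reduces [G] to bijections on fewer components. *)

Set Implicit Arguments.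
Unset Strict Implicit.
Unset Printing Implicit Defensive.

(** * Edge colouring of bipartite multigraphs *)

Lemma missing_colour (T : finType) s (D : {set T}) (e : T) (f : T -> 'I_s)
    (p : pred T) :
  e \notin D -> p e -> #|[set t | p t]| <= s ->
  exists c : 'I_s, forall t, t \in D -> p t -> f t != c.
Proof.
move=> eD pe les.
(* The uncoloured edge [e] is itself counted in the bound [s], which leaves at most [s - 1] colours
   in use at its end. *)
have ltc : #|f @: [set t in D | p t]| < s.
  apply: leq_ltn_trans (leq_imset_card _ _) _; apply: leq_trans les.
  apply/proper_card/properP; split.
    by apply/subsetP=> t; rewrite !inE => /andP[].
  by exists e; rewrite !inE // (negbTE eD).
have /subsetPn[c _ cf] : ~~ ([set: 'I_s] \subset f @: [set t in D | p t]).
  by apply/negP=> /subset_leq_card; rewrite cardsT card_ord leqNgt ltc.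
exists c => t tD pt; apply: contraNneq cf => <-.
by apply: imset_f; rewrite inE tD.
Qed.

Section EdgeColouring.
Variables (T A B : finType) (l : T -> A) (r : T -> B) (s : nat).

(** The elements of [T] are the edges, with ends given by [l] and [r]; parallel edges are thus
    allowed. Only the edges in [D] count as coloured. *)
Definition proper_colouring (D : {set T}) (f : T -> 'I_s) :=
  (forall t t', t \in D -> t' \in D -> f t = f t' -> l t = l t' -> t = t') /\
  (forall t t', t \in D -> t' \in D -> f t = f t' -> r t = r t' -> t = t').

Hypothesis degl : forall t, #|[set t' | l t' == l t]| <= s.
Hypothesis degr : forall t, #|[set t' | r t' == r t]| <= s.

Lemma extend_colouring (D : {set T}) (e : T) f :
  e \notin D -> proper_colouring D f -> exists h, proper_colouring (e |: D) h.
Proof.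
move=> eD [fl fr].
have [a a_free] := missing_colour f eD (eqxx (l e)) (degl e).
have [b b_free] := missing_colour f eD (eqxx (r e)) (degr e).
(* Kempe change: [W] is the set of right vertices reachable from [r e] along
   paths alternating between colours [a] and [b]; exchanging [a] and [b] on the
   edges ending in [W] frees [a] at [r e] and does not affect [l e]. *)
pose g w w' := [exists t, exists t',
  [&& t \in D, t' \in D, f t == a, f t' == b, r t == w, r t' == w'
    & l t == l t']].
pose W := [set w | connect g (r e) w].
(* The alternating path to [r t'] is not empty, as [b] is free at [r e]; its last [b]-edge must be
   [t'], and the [a]-edge before it is the required [t]. *)
have Wpred t' : t' \in D -> f t' = b -> r t' \in W ->
    exists t, [/\ t \in D, f t = a, l t = l t' & r t \in W].
  move=> t'D ft'; rewrite inE => /connectP[p].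
  case/lastP: p => [_ /= rt'|p w].
    by have := b_free t' t'D; rewrite rt' eqxx ft' eqxx => /(_ isT).
  rewrite rcons_path last_rcons => /andP[gp gl] wE.
  move: gl; rewrite -wE => /existsP[t /existsP[t2]].
  move=> /and5P[tD t2D /eqP ft /eqP ft2] /and3P[/eqP rt /eqP rt2 /eqP ll].
  have E2 : t2 = t' by apply: fr => //; rewrite ft2.
  exists t; rewrite -E2; split=> //; rewrite inE rt; apply/connectP.
  by exists p.
have Wsucc t t' : t \in D -> t' \in D -> f t = a -> f t' = b ->
    l t = l t' -> r t \in W -> r t' \in W.
  move=> tD t'D ft ft' ll; rewrite !inE => /connect_trans; apply.
  apply: connect1.
  by apply/existsP; exists t; apply/existsP; exists t'; rewrite tD t'D ft ft' ll !eqxx.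
pose sw c := if c == a then b else if c == b then a else c.
have swK : involutive sw.
  move=> c; rewrite /sw; case: (eqVneq c a) => [->|ca].
    by case: (eqVneq b a) => // _; rewrite eqxx.
  by case: (eqVneq c b) => [->|cb]; rewrite ?eqxx // (negbTE ca) (negbTE cb).
have sw_neq c d : c = sw d -> c = d \/ (c = a /\ d = b) \/ (c = b /\ d = a).
  rewrite /sw; case: (eqVneq d a) => [->|da]; first by auto.
  by case: (eqVneq d b) => [->|db]; auto.
pose h t := if t == e then a else if r t \in W then sw (f t) else f t.
(* A clash at a left vertex between an exchanged and an unexchanged edge would pair an [a]-edge with
   a [b]-edge, exactly one of them ending in [W]; [Wpred] and [Wsucc] forbid this. *)
have Wlr t t' : t \in D -> t' \in D -> l t = l t' ->
    r t \in W -> r t' \notin W -> sw (f t) = f t' -> t = t'.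
  move=> tD t'D ll rt rt' /esym/sw_neq[ff|[[ft' ft]|[ft' ft]]].
  - exact: fl.
  - have [t2 [t2D ft2 lt2 rt2]] := Wpred t tD ft rt.
    have E2 : t2 = t' by apply: fl => //; [rewrite ft2|rewrite lt2].
    by rewrite E2 (negbTE rt') in rt2.
  - by rewrite (Wsucc t t' tD t'D ft ft' ll rt) in rt'.
have hl t t' : t \in D -> t' \in D -> h t = h t' -> l t = l t' -> t = t'.
  move=> tD t'D; rewrite /h.
  have -> : t == e = false by apply: contraNF eD => /eqP <-.
  have -> : t' == e = false by apply: contraNF eD => /eqP <-.
  case: ifPn => rt; case: ifPn => rt' ff ll.
  - by apply: fl => //; apply: (inv_inj swK).
  - exact: Wlr.
  - by apply/esym/Wlr.
  - exact: fl.
have hr t t' : t \in D -> t' \in D -> h t = h t' -> r t = r t' -> t = t'.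
  move=> tD t'D; rewrite /h.
  have -> : t == e = false by apply: contraNF eD => /eqP <-.
  have -> : t' == e = false by apply: contraNF eD => /eqP <-.
  move=> ff rr; move: ff; rewrite -rr; case: ifPn => rt ff; apply: fr => //.
  exact: (inv_inj swK).
(* An edge at [l e] that acquires colour [a] had colour [b] and ends in [W], so [Wpred] yields an
   [a]-edge at [l e], where [a] was free. *)
have hel t : t \in D -> h t = h e -> l t <> l e.
  move=> tD; rewrite /h eqxx.
  have -> : t == e = false by apply: contraNF eD => /eqP <-.
  move=> ff ll; have la := a_free t tD; rewrite ll eqxx in la.
  move: ff; case: ifPn => rt ff; last by rewrite ff eqxx in la; have := la isT.
  have ft : f t = b.
    by rewrite -(swK (f t)) ff /sw eqxx.
  have [t2 [t2D ft2 lt2 rt2]] := Wpred t tD ft rt.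
  by have := a_free t2 t2D; rewrite lt2 ll ft2 !eqxx => /(_ isT).
(* Since [r e] lies in [W], an edge there with new colour [a] had the colour [b], which was free. *)
have her t : t \in D -> h t = h e -> r t <> r e.
  move=> tD; rewrite /h eqxx.
  have -> : t == e = false by apply: contraNF eD => /eqP <-.
  move=> ff rr; have lb := b_free t tD; rewrite rr eqxx in lb.
  have rW : r t \in W by rewrite inE rr connect0.
  have ft : f t = b.
    by move: ff; rewrite rW => ff; rewrite -(swK (f t)) ff /sw eqxx.
  by rewrite ft eqxx in lb; have := lb isT.
exists h; split=> t t'; rewrite !inE => /predU1P[->|tD] /predU1P[->|t'D] // hh ll.
- by have := hel t' t'D (esym hh) (esym ll).
- by have := hel t tD hh ll.
- exact: hl.
- by have := her t' t'D (esym hh) (esym ll).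
- by have := her t tD hh ll.
- exact: hr.
Qed.

Lemma konig_edge_colouring :
  exists f : T -> 'I_s,
    (forall t t', f t = f t' -> l t = l t' -> t = t') /\
    (forall t t', f t = f t' -> r t = r t' -> t = t').
Proof.
suff /(_ (enum T))[f [fl fr]] : forall xs : seq T,
    exists f, proper_colouring [set x in xs] f.
  by exists f; split=> t t' *; [apply: fl | apply: fr]; rewrite // inE mem_enum.
elim=> [|e xs [f pf]].
  (* Even with no edge coloured, a function into ['I_s] must be supplied; any element of [T] gives
     [0 < s] by the degree bound. *)
  have col0 (e : T) : 'I_s.
    apply: (@Ordinal _ 0); apply: leq_trans (degl e).
    by apply/card_gt0P; exists e; rewrite inE.
  by exists col0; split=> t t'; rewrite inE.
rewrite set_cons; have [eD|eD] := boolP (e \in [set x in xs]).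
  by exists f; rewrite (setUidPr _) // sub1set.
exact: extend_colouring pf.
Qed.

End EdgeColouring.

(** * In situ programs of bijections *)

Section Programs.
Variables (s n : nat).
Local Notation V := (vec s n).

(** Components stay in ['I_n], without the shift of [signature], so that the same fact serves both
    programs and networks. *)
Definition computes (l : seq 'I_n) (f : V -> V) : Prop :=
  exists2 p : seq (assignment s n),
    in_situ_program p f & [seq a.2 | a <- p] = l.

Lemma eq_computes l f g : f =1 g -> computes l f -> computes l g.
Proof. by move=> fg [p pf pl]; exists p => // X; rewrite pf. Qed.

Lemma computes_nil f : f =1 id -> computes [::] f.
Proof. by move=> f_id; exists [::] => // X; rewrite f_id. Qed.

Lemma computes_cat l1 l2 f g :
  computes l1 f -> computes l2 g -> computes (l1 ++ l2) (g \o f).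
Proof.
move=> [p pf pl] [q qg ql]; exists (p ++ q); last by rewrite map_cat pl ql.
by move=> X; rewrite foldl_cat pf qg.
Qed.

(** Turns a value described through the input [X] into a function of the current state [f X]. Off
    the image of [f], [Z i] is merely some element of ['I_s]. *)
Lemma factor_coordinate (i : 'I_n) (f : V -> V) (c : V -> 'I_s) :
  (forall X X', f X = f X' -> c X = c X') ->
  exists psi : V -> 'I_s, forall X, psi (f X) = c X.
Proof.
move=> fc; exists (fun Z => if [pick X | f X == Z] is Some X then c X else Z i).
by move=> X; case: pickP => [X' /eqP /fc // | /(_ X)]; rewrite eqxx.
Qed.

Lemma computes_upd (i : 'I_n) (c : V -> 'I_s) :
  computes [:: i] (fun X => upd X i (c X)).
Proof. by exists [:: (c, i)]. Qed.

(** The final assignment sees only the state [f X], which must therefore determine the new component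
    [i]. *)
Lemma computes_step l i (f g : V -> V) :
  computes l f ->
  (forall X j, j != i -> g X j = f X j) ->
  (forall X X', f X = f X' -> g X i = g X' i) ->
  computes (rcons l i) g.
Proof.
move=> cf gj gi; have [psi psiE] := factor_coordinate i gi.
rewrite -cats1; apply: eq_computes (computes_cat cf (computes_upd i psi)).
move=> X; apply/ffunP=> j /=; rewrite ffunE.
by case: eqP => [->|/eqP /gj //]; rewrite psiE.
Qed.

(** Erasing by [None] avoids renumbering the other components. *)
Definition forget (i : 'I_n) (X : V) : {ffun 'I_n -> option 'I_s} :=
  [ffun j => if j == i then None else Some (X j)].

Lemma forgetP i X Y : forget i X = forget i Y -> forall j, j != i -> X j = Y j.
Proof.
by move=> /ffunP XY j ji; have := XY j; rewrite !ffunE (negbTE ji) => -[].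
Qed.

Lemma forget_inj i X Y : forget i X = forget i Y -> X i = Y i -> X = Y.
Proof.
by move=> /forgetP XY Xi; apply/ffunP=> j; have [->|/XY] := eqVneq j i.
Qed.

(** The degree bound for the colouring: edges at one vertex are told apart by the erased component,
    which has [s] possible values. *)
Lemma forget_fibre i (G : V -> V) X :
  injective G -> #|[set Y | forget i (G Y) == forget i (G X)]| <= s.
Proof.
move=> injG; rewrite -[s in _ <= s]card_ord.
rewrite -(@card_in_imset _ _ (fun Y => G Y i)) ?max_card //.
move=> Y Y'; rewrite !inE => /eqP FY /eqP FY' YY'.
by apply/injG/(forget_inj _ YY'); rewrite FY FY'.
Qed.

Lemma forget_upd i X e : forget i (upd X i e) = forget i X.
Proof. by apply/ffunP=> j; rewrite !ffunE; case: eqP. Qed.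

Lemma upd_same (X : V) i e : upd X i e i = e.
Proof. by rewrite ffunE eqxx. Qed.

Lemma upd_other (X : V) i e j : j != i -> upd X i e j = X j.
Proof. by rewrite ffunE => /negbTE ->. Qed.

(** Properness of the colouring at each side makes [f1] and [f2] injective. The map taking [f1 X] to
    [f2 X] fixes component [i], which holds [col X] on both sides, so induction applies to it. As
    [f2] is injective, the state [f2 X] determines the value of [G X] at [i], written last. *)
Lemma computes_bijection_on (l : seq 'I_n) (G : V -> V) :
  injective G -> (forall X j, j \notin l -> G X j = X j) ->
  computes (l ++ rev l) G.
Proof.
elim: l G => [|i l IH] G injG Gfix.
  by apply: computes_nil => X; apply/ffunP=> j; rewrite Gfix.
have [col [colL colR]] := konig_edge_colouring
  (fun X => forget_fibre i X (inj_id (A := V))) (fun X => forget_fibre i X injG).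
pose f1 X := upd X i (col X); pose f2 X := upd (G X) i (col X).
have inj_f1 : injective f1.
  move=> X Y XY; apply: colL.
    by rewrite -(upd_same X i (col X)) -/(f1 X) XY upd_same.
  by rewrite -(forget_upd i X (col X)) -/(f1 X) XY forget_upd.
have inj_f2 : injective f2.
  move=> X Y XY; apply: colR.
    by rewrite -(upd_same (G X) i (col X)) -/(f2 X) XY upd_same.
  by rewrite -(forget_upd i (G X) (col X)) -/(f2 X) XY forget_upd.
have [g1 f1K g1K] := injF_bij inj_f1.
have cH : computes (l ++ rev l) (f2 \o g1).
  apply: IH; first exact: inj_comp inj_f2 (can_inj g1K).
  move=> X j jl; rewrite -[X in RHS]g1K /=; have [->|ji] := eqVneq j i.
    by rewrite !upd_same.
  by rewrite !upd_other // Gfix // inE negb_or ji.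
rewrite rev_cons -rcons_cat.
apply: (@computes_step _ _ f2).
- apply: eq_computes (computes_cat (computes_upd i col) cH) => X /=.
  by rewrite -/(f1 X) f1K.
- by move=> X j ji; rewrite upd_other.
- by move=> X X' /inj_f2 ->.
Qed.

Lemma computes_bijection (l : seq 'I_n) (G : V -> V) :
  injective G -> (forall j, j \in l) -> computes (l ++ rev l) G.
Proof. by move=> injG lT; apply: computes_bijection_on => // X j; rewrite lT. Qed.

(** * Digits and indices of vectors *)

Definition digit (X : V) (j : nat) : nat :=
  oapp (fun i => nat_of_ord (X i)) 0 (insub j).

Lemma digitE X (i : 'I_n) : digit X i = X i.
Proof. by rewrite /digit valK. Qed.

Lemma digit_max X j : j < n -> digit X j < s.
Proof. by move=> jn; rewrite -[j]/(nat_of_ord (Ordinal jn)) digitE. Qed.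

(** For [i <= n] this is the index of [X] modulo [s ^ i]. *)
Definition low (X : V) i := \sum_(0 <= j < i) s ^ j * digit X j.

Lemma vindexE X : vindex X = low X n.
Proof. by rewrite /low big_mkord; apply: eq_bigr => i _; rewrite digitE. Qed.

Lemma low_recr X i : low X i.+1 = low X i + s ^ i * digit X i.
Proof. by rewrite /low big_nat_recr. Qed.

Lemma low_max X i : i <= n -> low X i < s ^ i.
Proof.
elim: i => [|i IH] lein; first by rewrite /low big_geq.
rewrite low_recr expnS; have := IH (ltnW lein); have := digit_max X lein.
nia.
Qed.

Lemma low_split X i : i <= n ->
  vindex X = low X i + s ^ i * \sum_(i <= j < n) s ^ (j - i) * digit X j.
Proof.
move=> lein; rewrite vindexE /low (big_cat_nat _ (n := i)) //=; congr (_ + _).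
rewrite big_distrr /=; apply: eq_big_nat => j /andP[ij _].
by rewrite mulnA -expnD subnKC.
Qed.

Lemma low_digits X Y i : i <= n -> low X i = low Y i ->
  forall j, j < i -> digit X j = digit Y j.
Proof.
elim: i => // i IH lein; rewrite !low_recr => XY j.
have lX := low_max X (ltnW lein); have lY := low_max Y (ltnW lein).
have [E1 E2] : low X i = low Y i /\ digit X i = digit Y i.
  suff E2 : digit X i = digit Y i by move: XY; rewrite E2 => /addIn.
  (* Division by [s ^ i] isolates the leading digit; [lX] also shows that [s ^ i] is positive. *)
  move/(congr1 (divn^~ (s ^ i))): XY.
  rewrite !(addnC (low _ _)) !(mulnC (s ^ i)) !divnMDl ?(leq_trans _ lX) //.
  by rewrite !divn_small // !addn0.
by rewrite ltnS leq_eqVlt => /predU1P[->//|]; apply: IH => //; apply: ltnW.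
Qed.

Lemma vindex_inj : injective (@vindex s n).
Proof.
move=> X Y; rewrite !vindexE => XY; apply/ffunP=> i; apply: val_inj => /=.
by rewrite -!digitE; apply: low_digits XY _ _.
Qed.

Lemma vindex_max (X : V) : vindex X < s ^ n.
Proof. by rewrite vindexE low_max. Qed.

Lemma card_vec : #|V| = s ^ n.
Proof. by rewrite card_ffun !card_ord. Qed.

Lemma vindex_onto i : i < s ^ n -> exists X : V, vindex X = i.
Proof.
move=> lti.
pose f (X : V) := Ordinal (vindex_max X).
have /inj_card_onto onto : injective f by move=> X Y [] /vindex_inj.
have /codomP[X Xi] : Ordinal lti \in codom f.
  by apply: onto; rewrite card_ord card_vec.
by exists X; rewrite -[i]/(val (Ordinal lti)) Xi.
Qed.

Lemma vec_atP i X : (vec_at s n i == Some X) = (vindex X == i).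
Proof.
rewrite /vec_at; case: pickP => [Y /eqP <-|/(_ X) ->] //.
by rewrite (inj_eq (@Some_inj _)) eq_sym; apply/eqP/eqP => [->|/vindex_inj].
Qed.

(** * In situ programs of index contractions *)

Definition index_contraction (I : V -> V) : Prop :=
  forall X Y, vindex X <= vindex Y ->
    vindex (I X) <= vindex (I Y) <= vindex (I X) + (vindex Y - vindex X).

(* If [X], [Y] agree from component [i] on and [I X], [I Y] agree before
   component [i], then the index of [I X] and [I Y] differ by a multiple of
   [s ^ i] that is smaller than [s ^ i]. *)
Lemma index_contraction_eq (I : V -> V) i X Y : index_contraction I ->
  (forall j : 'I_n, j < i -> I X j = I Y j) ->
  (forall j : 'I_n, i <= j -> X j = Y j) -> I X = I Y.
Proof.
move=> cI.
wlog leXY : X Y / vindex X <= vindex Y.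
  move=> H; case/orP: (leq_total (vindex X) (vindex Y)) => [/H //|/H H' lo hi].
  by rewrite H' // => j /[dup]; [move/lo|move/hi].
have [lein|ltni] := leqP i n; last first.
  by move=> lo _; apply/ffunP=> j; apply: lo; apply: ltn_trans ltni.
move=> lo hi; apply: vindex_inj.
have digXY j : i <= j < n -> digit X j = digit Y j.
  by case/andP=> ij jn; rewrite -[j]/(nat_of_ord (Ordinal jn)) !digitE hi.
have lowXY : low (I X) i = low (I Y) i.
  rewrite /low; apply: eq_big_nat => j /= ji.
  by rewrite -[j]/(nat_of_ord (Ordinal (leq_trans ji lein))) !digitE lo.
have := cI X Y leXY; rewrite !(low_split _ lein) lowXY.
rewrite (eq_big_nat _ _ (F1 := fun j => s ^ (j - i) * digit X j)
  (F2 := fun j => s ^ (j - i) * digit Y j)); last first.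
  by move=> j jin; rewrite digXY.
have lX := low_max X lein; have lY := low_max Y lein.
set a := \sum_(_ <= _ < _) _; set b := \sum_(_ <= _ < _) _.
set c := \sum_(_ <= _ < _) _.
rewrite subnDr -addnA !leq_add2l => /andP[ab ba]; congr (_ + _).
have si_gt0 : 0 < s ^ i by apply: leq_ltn_trans lX.
rewrite leq_pmul2l // in ab; congr (_ * _); apply/eqP; rewrite eqn_leq ab.
rewrite -ltnS -(ltn_pmul2l si_gt0) mulnS.
apply: leq_ltn_trans ba _; rewrite addnC ltn_add2r.
exact: leq_ltn_trans (leq_subr _ _) lY.
Qed.

(** The state [W i X] after [i] assignments has its first [i] components from [I X] and the others
    from [X]. By [index_contraction_eq] it determines all of [I X], hence the next component. *)
Lemma computes_index_contraction (I : V -> V) :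
  index_contraction I -> computes (enum 'I_n) I.
Proof.
move=> cI; pose W i X : V := [ffun j : 'I_n => if j < i then I X j else X j].
have WI : W n =1 I by move=> X; apply/ffunP=> j; rewrite ffunE ltn_ord.
suff H i : i <= n -> computes (take i (enum 'I_n)) (W i).
  apply: eq_computes WI _.
  by rewrite -[enum _](@take_oversize _ n) ?size_enum_ord //; apply: H.
elim: i => [_|i IH lein].
  by rewrite take0; apply: computes_nil => X; apply/ffunP=> j; rewrite ffunE.
rewrite (take_nth (Ordinal lein)) ?size_enum_ord //.
have -> : nth (Ordinal lein) (enum 'I_n) i = Ordinal lein.
  by rewrite -[i in nth _ _ i]/(val (Ordinal lein)) nth_ord_enum.
apply: computes_step (IH (ltnW lein)) _ _ => [X j ji | X X' /ffunP WXX'].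
  by rewrite !ffunE ltnS leq_eqVlt (negbTE (ji : nat_of_ord j != i)).
rewrite !ffunE /= ltnS leqnn; suff -> : I X = I X' by [].
apply: (index_contraction_eq cI (i := i)) => j.
  by move=> ji; have := WXX' j; rewrite !ffunE ji.
by move=> ij; have := WXX' j; rewrite !ffunE ltnNge ij.
Qed.

End Programs.

(** * Block lengths and factorisations *)

Lemma reshape_index_cons c sh i :
  reshape_index (c :: sh) i =
    if i < c then 0 else (reshape_index sh (i - c)).+1.
Proof.
rewrite /reshape_index /= subn_eq0; case: ltnP => // ci.
by rewrite subSn.
Qed.

(** [reshape_index sh i] is the number of the block containing position [i]. As no block is empty,
    one step to the right advances by at most one block. *)
Lemma reshape_index_contraction sh i j : all (ltn 0) sh -> i <= j ->
  reshape_index sh i <= reshape_index sh j <= reshape_index sh i + (j - i).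
Proof.
elim: sh i j => [|c sh IH] i j //= /andP[c_gt0 sh_gt0] leij.
rewrite !reshape_index_cons; case: (ltnP i c) => ci; case: (ltnP j c) => cj //=.
- have /andP[_] := IH 0 (j - c) sh_gt0 isT.
  have -> : reshape_index sh 0 = 0.
    case: sh sh_gt0 {IH} => // d sh /= /andP[d0 _].
    by rewrite reshape_index_cons d0.
  lia.
- lia.
- have /andP[] := IH (i - c) (j - c) sh_gt0 (leq_sub2r c leij); lia.
Qed.

Section Factorisation.
Variables (s n : nat).
Local Notation V := (vec s n).

Lemma reshape_index_index_contraction sh (I : V -> V) : all (ltn 0) sh ->
  (forall X, vindex (I X) = reshape_index sh (vindex X)) -> index_contraction I.
Proof.
by move=> sh_gt0 IE X Y XY; rewrite !IE; apply: reshape_index_contraction.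
Qed.

Lemma partition_sequence_sum k (P : k.+1.-tuple {set V}) :
  partition_sequence P -> (forall i, tnth P i != set0) ->
  sumn [seq #|tnth P i| | i <- enum 'I_k.+1] = s ^ n.
Proof.
move=> [uP partP] P_neq0.
have P_all : {in P, forall A, A != set0} by move=> A /tnthP[i ->].
have filterP : [seq A <- P | A != set0] = P.
  by apply/all_filterP/allP.
rewrite filterP in uP.
rewrite -card_vec -cardsT (card_partition partP) sumnE big_map big_enum.
rewrite -(big_tuple _ _ P predT (fun A => #|A|)) /= big_uniq //=.
by apply: eq_bigl => A; rewrite inE; have [/P_all ->|] := boolP (A \in P).
Qed.

Lemma vindex_I_of k (P : k.+1.-tuple {set V}) X :
  partition_sequence P -> (forall i, tnth P i != set0) ->
  vindex (I_of P X) =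
    reshape_index [seq #|tnth P i| | i <- enum 'I_k.+1] (vindex X).
Proof.
move=> partP P_neq0; set sh := map _ _.
have shE : sumn sh = s ^ n := partition_sequence_sum partP P_neq0.
have sh_gt0 : all (ltn 0) sh.
  by apply/allP=> _ /mapP[i _ ->]; rewrite /= card_gt0.
have size_sh : size sh = k.+1 by rewrite size_map size_enum_ord.
have ltr : reshape_index sh (vindex X) < k.+1.
  by rewrite -size_sh reshape_indexP // shE vindex_max.
(* Each of the [k.+1] blocks takes up at least one of the [s ^ n] positions. Hence block numbers are
   indices of vectors, and the default in [I_of] is not reached. *)
have ltk : k.+1 <= s ^ n.
  rewrite -shE -size_sh.
  by elim: sh sh_gt0 {shE size_sh ltr} => //= c sh IH /andP[c0 /IH]; lia.
have [Y YE] := @vindex_onto s n _ (leq_trans ltr ltk).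
rewrite /I_of nth_flatten.
have -> : shape [seq nseq #|tnth P i| (vec_at s n i) | i <- enum 'I_k.+1] = sh.
  by rewrite /shape -map_comp; apply: eq_map => i /=; rewrite size_nseq.
rewrite (nth_map ord0) ?size_enum_ord // nth_nseq.
have := reshape_offsetP (_ : vindex X < sumn sh).
rewrite (nth_map ord0) ?size_enum_ord // => -> //; last by rewrite shE vindex_max.
rewrite nth_enum_ord //.
by have /eqP -> : vec_at s n (reshape_index sh (vindex X)) == Some Y;
  rewrite ?vec_atP YE.
Qed.

(** Follow the member [tnth P i] containing [X]: [G] and then [I] lead to the vector of index [i],
    which [F] sends to the value of [E] on that member. *)
Lemma factorisation_comp k (P : k.+1.-tuple {set V}) E F I G :
  factorisation P E F I G -> E =1 F \o I \o G.
Proof.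
move=> [[_ partP] _ [_ GP] [_ FP]] X /=.
have : X \in cover [set A in P | A != set0] by rewrite (cover_partition partP) inE.
case/bigcupP=> A; rewrite inE => /andP[/tnthP[i ->] Pi] XPi.
have [y PE Fy] := FP i Pi.
have : G X \in G @: tnth P i by apply: imset_f.
rewrite GP inE => /eqP IG; move: Fy; rewrite -IG => -[->].
by move: XPi; rewrite PE inE => /eqP.
Qed.

Lemma factorisation_contraction k (P : k.+1.-tuple {set V}) E F I G :
  factorisation P E F I G -> (forall i, tnth P i != set0) -> index_contraction I.
Proof.
move=> [partP IE _ _] P_neq0.
pose sh := [seq #|tnth P i| | i <- enum 'I_k.+1].
apply: (@reshape_index_index_contraction sh) => [|X]; last first.
  by rewrite IE vindex_I_of.
by apply/allP=> _ /mapP[i _ ->]; rewrite /= card_gt0.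
Qed.

(** For [F] the reversed list comes first, so that each program starts on the component where the
    preceding one ends. *)
Lemma factor_computes (F I G : V -> V) (e := enum 'I_n) :
  bijective F -> index_contraction I -> bijective G ->
  [/\ computes (e ++ rev e) G, computes e I & computes (rev e ++ e) F].
Proof.
move=> bijF cI bijG; have eT j : j \in e by rewrite mem_enum.
split; last rewrite -[in X in _ ++ X](revK e).
- by apply: computes_bijection => //; apply: bij_inj.
- exact: computes_index_contraction.
- by apply: computes_bijection => [|j]; [apply: bij_inj | rewrite mem_rev].
Qed.

Lemma nth_vindex_inj (L : seq V) : uniq L -> size L = s ^ n ->
  injective (fun X => nth X L (vindex X)).
Proof.
move=> uL sL X Y; rewrite (set_nth_default Y) ?sL ?vindex_max // => /eqP.
by rewrite nth_uniq ?sL ?vindex_max // => /eqP /vindex_inj.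
Qed.

(** [L] lists the fibres of [E] in the order of the image [U], and [G] sends a vector to its
    position in [L]. Positions in the [i]-th fibre are sent to index [i]. [F] reads off [L'], which
    is [U] completed to a list of all vectors so that [F] is bijective. *)
Lemma contraction_factorisation (E : V -> V) :
  exists F I G : V -> V,
    [/\ E =1 F \o I \o G, bijective F, index_contraction I & bijective G].
Proof.
pose U := enum [set E X | X : V].
pose fib y := enum [set X | E X == y].
pose L := flatten [seq fib y | y <- U].
pose sh := [seq #|[set X | E X == y]| | y <- U].
have shE : shape [seq fib y | y <- U] = sh.
  by rewrite /shape -map_comp; apply: eq_map => y /=; rewrite -cardE.
have sh_sum : sumn sh = s ^ n.
  rewrite sumnE big_map big_enum /= -card_vec -sum1_card [RHS](partition_big_imset E) /=.
  by apply: eq_bigr => y _; rewrite -sum1_card; apply: eq_bigl => X; rewrite inE.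
have sh_gt0 : all (ltn 0) sh.
  apply/allP=> _ /mapP[y yU ->] /=; apply/card_gt0P.
  by move: yU; rewrite mem_enum => /imsetP[X _ ->]; exists X; rewrite inE.
have size_L : size L = s ^ n by rewrite size_flatten shE.
have uL : uniq L.
  apply: (leq_size_uniq (enum_uniq V)); last by rewrite size_L -cardE card_vec.
  move=> X _; apply/flatten_mapP; exists (E X).
    by rewrite mem_enum imset_f.
  by rewrite mem_enum inE.
pose L' := U ++ [seq X <- enum V | X \notin U].
have uL' : uniq L'.
  rewrite cat_uniq enum_uniq filter_uniq ?enum_uniq // andbT.
  by apply/hasPn=> X; rewrite mem_filter => /andP[].
have size_L' : size L' = s ^ n.
  rewrite -card_vec cardE; apply/perm_size/uniq_perm; rewrite ?enum_uniq //.
  by move=> X; rewrite mem_cat mem_filter !mem_enum andbT orbN.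
have ltr (X : V) : reshape_index sh (vindex X) < size U.
  have := @reshape_indexP sh (vindex X); rewrite size_map; apply.
  by rewrite sh_sum vindex_max.
have U_max : size U <= s ^ n by rewrite -size_L' size_cat leq_addr.
have [H HE] : exists I : V -> V,
    forall X, vindex (I X) = reshape_index sh (vindex X).
  exists (fun X => odflt X (vec_at s n (reshape_index sh (vindex X)))) => X.
  have [Y YE] := @vindex_onto s n _ (leq_trans (ltr X) U_max).
  by have /eqP -> : vec_at s n (reshape_index sh (vindex X)) == Some Y;
    rewrite ?vec_atP YE.
have bijK := injF_bij (nth_vindex_inj uL size_L).
have [G GK KG] := bijK.
exists (fun X => nth X L' (vindex X)), H, G; split.
(* [X] is the entry of [L] at position [vindex (G X)], so it lies in the fibre over the entry of [U]
   numbered by its block. *)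
- move=> X /=; rewrite HE -{1}[X]KG; set Y := G X; set Z := H Y.
  rewrite nth_flatten shE nth_cat ltr.
  rewrite (nth_map Z) ?ltr //; set y := nth Z U _.
  have : nth Y (fib y) (reshape_offset sh (vindex Y)) \in fib y.
    rewrite mem_nth // -cardE.
    have := reshape_offsetP (_ : vindex Y < sumn sh).
    by rewrite (nth_map Z) ?ltr //; apply; rewrite sh_sum vindex_max.
  by rewrite mem_enum inE => /eqP.
- exact: injF_bij (nth_vindex_inj uL' size_L').
- exact: reshape_index_index_contraction sh_gt0 HE.
- by exists (fun X => nth X L (vindex X)).
Qed.

End Factorisation.

(** * Merging and repetitions in signatures *)

Section Destutter.
Variable T : eqType.

(** The effect of [merge_program] on signatures, as [signature_merge] shows. *)
Fixpoint destutter (s : seq T) : seq T :=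
  if s is x :: s' then
    let q := destutter s' in if ohead q == Some x then q else x :: q
  else [::].

Lemma destutter_cons x s : destutter (x :: s) =
  if ohead (destutter s) == Some x then destutter s else x :: destutter s.
Proof. by []. Qed.

(** Shaped for the junction of two signatures, the first ending with the entry that starts the
    second. *)
Lemma destutter_dup s1 x s2 :
  destutter (rcons s1 x ++ x :: s2) = destutter (rcons s1 x ++ s2).
Proof.
rewrite !cat_rcons; elim: s1 => [|y s1 /= -> //] /=.
by case: (eqVneq (ohead (destutter s2)) (Some x)) => [e | _] /=;
  rewrite ?e eqxx.
Qed.

Lemma destutter_id s : sorted (fun x y => x != y) s -> destutter s = s.
Proof.
elim: s => // x [|y s] IH // /andP[xy ps]; rewrite destutter_cons {}IH //=.
by rewrite (inj_eq (@Some_inj _)) eq_sym (negbTE xy).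
Qed.

End Destutter.

Section Merge.
Variables (s n : nat).

Lemma foldl_exec_merge (p : seq (assignment s n)) X :
  foldl (@exec s n) X (merge_program p) = foldl (@exec s n) X p.
Proof.
elim: p X => //= a p IH X; rewrite -IH.
case: (merge_program p) => //= b q; case: eqP => //= ab.
congr (foldl _ _ _); apply/ffunP=> j; rewrite !ffunE /= -ab.
by case: eqP.
Qed.

Lemma signature_merge (p : seq (assignment s n)) :
  signature (merge_program p) = destutter (signature p).
Proof.
elim: p => //= a p <-; case: (merge_program p) => //= b q.
rewrite (inj_eq (@Some_inj _)) eqSS (inj_eq (@ord_inj _)) (eq_sym b.2).
by case: eqP => //= ->.
Qed.

Lemma size_signature (p : seq (assignment s n)) : size (signature p) = size p.
Proof. exact: size_map. Qed.

End Merge.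

(** * Computation of the signatures *)

Lemma signature_coordinates s n (p : seq (assignment s n)) :
  signature p = [seq (nat_of_ord i).+1 | i <- [seq a.2 | a <- p]].
Proof. by rewrite -map_comp. Qed.

Lemma up_enum n : [seq (nat_of_ord i).+1 | i <- enum 'I_n] = up 1 n.
Proof. by rewrite (map_comp S val) val_enum_ord /up subn1 (iotaDl 1 0). Qed.

Lemma down_enum n : [seq (nat_of_ord i).+1 | i <- rev (enum 'I_n)] = down n 1.
Proof. by rewrite map_rev up_enum. Qed.

Lemma size_up a b : size (up a b) = b.+1 - a.
Proof. exact: size_iota. Qed.

Lemma size_down b a : size (down b a) = b.+1 - a.
Proof. by rewrite size_rev size_up. Qed.

Lemma up_recl a b : a <= b -> up a b = a :: up a.+1 b.
Proof. by move=> ab; rewrite /up subSn. Qed.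

Lemma up_recr a b : a <= b.+1 -> up a b.+1 = rcons (up a b) b.+1.
Proof. by move=> ab; rewrite /up subSn // -addn1 iotaD subnKC // cats1. Qed.

Lemma down_recl a b : a <= b.+1 -> down b.+1 a = b.+1 :: down b a.
Proof. by move=> ab; rewrite /down up_recr // rev_rcons. Qed.

Lemma down_recr a b : a <= b -> down b a = rcons (down b a.+1) a.
Proof. by move=> ab; rewrite /down up_recl // rev_cons. Qed.

Lemma size_signature_E n : 0 < n -> size (signature_E n) = 5 * n - 4.
Proof. by move=> n_gt0; rewrite !size_cat !(size_up, size_down); lia. Qed.

Lemma sorted_cons (T : Type) (e : rel T) x l : sorted e (x :: l) = path e x l.
Proof. by []. Qed.

Lemma up_path x a b : x < a -> path (fun x y => x != y) x (up a b).
Proof.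
move=> xa; apply: (sub_path (e := ltn)) => [y z|].
  by rewrite /= ltn_neqAle => /andP[].
rewrite /up; move: (_ - _) => m.
by elim: m x a xa => //= m IH x a ->; apply: IH.
Qed.

Lemma down_path x a b : b < x -> path (fun x y => x != y) x (down b a).
Proof.
move=> bx; apply: (sub_path (e := gtn)) => [y z|].
  by rewrite /= ltn_neqAle eq_sym => /andP[].
elim: b x bx => [|b IH] x bx.
  case: a => [|a]; first by rewrite /= bx.
  by rewrite /down /up subSS sub0n.
have [ab|ab] := leqP a b.+1; first by rewrite down_recl //= bx IH.
by rewrite /down /up (eqP (_ : b.+2 - a == 0)) // subn_eq0.
Qed.

Lemma last_up x b : last x (up 2 b.+2) = b.+2.
Proof. by rewrite up_recr // last_rcons. Qed.

Lemma last_down x b : last x (down b.+1 1) = 1.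
Proof. by rewrite down_recr // last_rcons. Qed.

Lemma destutter_signature_G n : 0 < n ->
  destutter (up 1 n ++ down n 1) = signature_G n.
Proof.
case: n => // -[|n] _ //.
rewrite /signature_G down_recl // up_recr // destutter_dup.
apply: destutter_id; rewrite -up_recr // up_recl // cat_cons sorted_cons.
by rewrite cat_path up_path // last_up down_path.
Qed.

Lemma destutter_signature_F n : 0 < n ->
  destutter (down n 1 ++ up 1 n) = signature_F n.
Proof.
case: n => // -[|n] _ //.
rewrite /signature_F down_recr // up_recl // destutter_dup.
apply: destutter_id; rewrite -down_recr // down_recl // cat_cons sorted_cons.
by rewrite cat_path down_path // last_down up_path.
Qed.

Lemma sorted_signature_E n : sorted (fun x y => x != y) (signature_E n.+2).
Proof.
rewrite /signature_E up_recl // cat_cons sorted_cons.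
rewrite !cat_path !last_up !last_down.
by rewrite !down_path // !up_path.
Qed.

(** Repetitions occur only at the two junctions: the entry [1] between [G] and [I], the entry [n]
    between [I] and [F]. *)
Lemma destutter_signature_E n : 0 < n ->
  destutter (signature_G n ++ signature_I n ++ signature_F n) = signature_E n.
Proof.
(* For [n = 1] all three signatures are [[:: 1]] and collapse to a single entry. *)
case: n => // -[|n] _ //; rewrite -(destutter_id (sorted_signature_E n)).
rewrite /signature_G /signature_I /signature_F /signature_E.
set U := up 2 n.+2; set D := down n.+1 1.
have eD : D = rcons (down n.+1 2) 1 by rewrite -down_recr.
have eU : U = rcons (up 2 n.+1) n.+2 by rewrite -up_recr.
have -> : down n.+2 1 = n.+2 :: D by rewrite down_recl.
have -> : up 1 n.+2 = 1 :: U by rewrite up_recl.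
transitivity (destutter (((1 :: U) ++ D) ++ U ++ n.+2 :: D ++ U)).
  by rewrite {1 3}eD -rcons_cat [LHS]destutter_dup.
rewrite catA [in X in X ++ n.+2 :: _]eU -rcons_cat [LHS]destutter_dup.
by rewrite rcons_cat -eU -!catA.
Qed.

(** * Routings and multicast routings from programs *)

Section Networks.
Variables (s n : nat).
Local Notation V := (vec s n).
Local Notation assign_edge i :=
  (fun X Y : V => [exists e : 'I_s, Y == upd X i e]).

(** An assignment network is its own reversal, so reversing the list of components reverses the
    whole network. *)
Lemma assign_edge_sym (i : 'I_n) X Y : assign_edge i X Y -> assign_edge i Y X.
Proof.
case/existsP=> e /eqP ->; apply/existsP; exists (X i).
by apply/eqP/ffunP=> j; rewrite !ffunE; case: eqP => [->|].
Qed.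

Lemma B_invE : B_inv s n = [seq assign_edge i | i <- enum 'I_n].
Proof. by rewrite /B_inv; elim: (enum _) => //= i l ->. Qed.

Lemma BE : B s n = [seq assign_edge i | i <- rev (enum 'I_n)].
Proof. by rewrite /B; elim: (rev _) => //= i l ->. Qed.

Lemma computes_routing (l : seq 'I_n) (E : V -> V) : computes l E ->
  exists C : network s n, routing_performing [seq assign_edge i | i <- l] C E.
Proof.
move=> [p pE <-]; exists [seq (fun X Y => Y == exec X a) | a <- p]; split.
- rewrite -map_comp; split; first by rewrite !size_map.
  rewrite /edge; elim: p {pE} => [|a p IH] [|t] X Y //=; last exact: IH.
  by move=> /eqP ->; apply/existsP; exists (a.1 X).
- rewrite /edge; elim: p {pE} => [|a p IH] [|t] X //= ltt; last exact: IH.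
  by exists (exec X a); split=> // Y /eqP.
- move=> X; rewrite -pE; elim: p X {pE} => //= a p IH X.
  by apply/existsP; exists (exec X a); rewrite eqxx IH.
Qed.

(** In a reversed network the first assignment of a program becomes the last edge, so [reach] has to
    be unfolded from the end. *)
Lemma reach_rcons (C : network s n) e X Y :
  reach (rcons C e) X Y = [exists Z, reach C X Z && e Z Y].
Proof.
elim: C X => [|d C IH] X /=.
  apply/existsP/existsP=> -[Z].
    by move=> /andP[eXZ /eqP <-]; exists X; rewrite eqxx.
  by move=> /andP[/eqP <- eXY]; exists Y; rewrite eXY eqxx.
apply/existsP/existsP=> -[Z].
  rewrite IH => /andP[dXZ /existsP[Z' /andP[rZ eZ]]].
  exists Z'; rewrite eZ andbT.
  by apply/existsP; exists Z; rewrite dXZ.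
move=> /andP[/existsP[Z' /andP[dX rZ]] eZ]; exists Z'; rewrite dX IH.
by apply/existsP; exists Z; rewrite rZ.
Qed.

(** A routing of [E] read backwards: the only chosen edge into [Y] comes from [exec Y a], so
    following edges back from the final stage executes the program. *)
Lemma computes_multicast (l : seq 'I_n) (E : V -> V) : computes l E ->
  exists C : network s n,
    multicast_performing_inverse [seq assign_edge i | i <- rev l] C E.
Proof.
move=> [p pE <-]; exists [seq (fun X Y => X == exec Y a) | a <- rev p]; split.
- rewrite -map_rev -map_comp; split; first by rewrite !size_map.
  rewrite /edge; elim: (rev p) => [|a q IH] [|t] X Y //=; last exact: IH.
  by move=> /eqP ->; apply: assign_edge_sym; apply/existsP; exists (a.1 Y).
- rewrite /edge; elim: (rev p) => [|a q IH] [|t] Y //= ltt; last exact: IH.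
  by exists (exec Y a); split=> // X /eqP.
- move=> Y; apply/setP=> X; rewrite !inE -pE [RHS]eq_sym.
  elim: p X {pE} => //= a p IH X.
  rewrite rev_cons map_rcons reach_rcons.
  apply/existsP/eqP=> [[Z /andP[]]|YE].
    by rewrite IH => /eqP -> /eqP ->.
  by exists (exec X a); rewrite IH YE !eqxx.
Qed.

End Networks.

(** * Assembly of programs and networks *)

Lemma computes_program s n (l : seq 'I_n) (f : vec s n -> vec s n) :
  computes l f -> exists p : seq (assignment s n),
    in_situ_program p f /\
    signature p = destutter [seq (nat_of_ord i).+1 | i <- l].
Proof.
move=> [p pf <-]; exists (merge_program p); split.
  by move=> X; rewrite foldl_exec_merge.
by rewrite signature_merge signature_coordinates.
Qed.

Lemma merged_program s n (E F I G : vec s n -> vec s n)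
    (pG pI pF : seq (assignment s n)) :
  0 < n -> E =1 F \o I \o G ->
  in_situ_program pG G -> signature pG = signature_G n ->
  in_situ_program pI I -> signature pI = signature_I n ->
  in_situ_program pF F -> signature pF = signature_F n ->
  [/\ in_situ_program (merge_program (pG ++ pI ++ pF)) E,
      size (merge_program (pG ++ pI ++ pF)) = 5 * n - 4
    & signature (merge_program (pG ++ pI ++ pF)) = signature_E n].
Proof.
move=> n_gt0 EE pGG sG pII sI pFF sF.
have sE : signature (merge_program (pG ++ pI ++ pF)) = signature_E n.
  rewrite signature_merge /signature !map_cat -!/(signature _) sG sI sF.
  exact: destutter_signature_E.
split=> //; last by rewrite -size_signature sE size_signature_E.
by move=> X; rewrite foldl_exec_merge !foldl_cat pGG pII pFF EE.
Qed.

Lemma factor_programs s n (F I G : vec s n -> vec s n) :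
  0 < n -> bijective F -> index_contraction I -> bijective G ->
  [/\ exists pG : seq (assignment s n),
        in_situ_program pG G /\ signature pG = signature_G n,
      exists pI : seq (assignment s n),
        in_situ_program pI I /\ signature pI = signature_I n
    & exists pF : seq (assignment s n),
        in_situ_program pF F /\ signature pF = signature_F n].
Proof.
move=> n_gt0 bijF cI bijG; have [cG {}cI cF] := factor_computes bijF cI bijG.
rewrite -destutter_signature_G // -destutter_signature_F //.
rewrite -up_enum -down_enum -!map_cat.
split; try exact: computes_program.
(* A single sweep repeats no component, so the program of [I] is taken unmerged. *)
have [p pI pl] := cI; exists p; split=> //.
by rewrite signature_coordinates pl up_enum.
Qed.

Theorem theorem12 (s n : nat) (n_gt0 : 0 < n) (E : vec s n -> vec s n) :
  (exists p : seq (assignment s n),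
     [/\ in_situ_program p E,
         size p = 5 * n - 4
       & signature p = signature_E n])
  /\
  (forall (k : nat) (P : k.+1.-tuple {set vec s n})
          (F I G : vec s n -> vec s n),
     factorisation P E F I G ->
     (forall i : 'I_k.+1, tnth P i != set0) ->
     [/\ exists pG : seq (assignment s n),
           in_situ_program pG G /\ signature pG = signature_G n,
         exists pI : seq (assignment s n),
           in_situ_program pI I /\ signature pI = signature_I n,
         exists pF : seq (assignment s n),
           in_situ_program pF F /\ signature pF = signature_F n
       & forall pG pI pF : seq (assignment s n),
           in_situ_program pG G -> signature pG = signature_G n ->
           in_situ_program pI I -> signature pI = signature_I n ->
           in_situ_program pF F -> signature pF = signature_F n ->
           [/\ in_situ_program (merge_program (pG ++ pI ++ pF)) E,
               size (merge_program (pG ++ pI ++ pF)) = 5 * n - 4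
             & signature (merge_program (pG ++ pI ++ pF)) = signature_E n]])
  /\
  (exists C : network s n,
     routing_performing
       (B_inv s n ++ B s n ++ B_inv s n ++ B s n ++ B_inv s n) C E)
  /\
  (exists C : network s n,
     multicast_performing_inverse
       (B s n ++ B_inv s n ++ B s n ++ B_inv s n ++ B s n) C E).
Proof.
have [F0 [I0 [G0 [E0 bijF0 cI0 bijG0]]]] := contraction_factorisation E.
(* The networks consist of five full sweeps, so here the assignments at the junctions stay
   unmerged. *)
have cE : let e := enum 'I_n in computes (e ++ rev e ++ e ++ rev e ++ e) E.
  have [cG cI cF] := factor_computes bijF0 cI0 bijG0.
  apply: (@eq_computes _ _ _ ((F0 \o I0) \o G0)); first by move=> X; rewrite E0.
  by rewrite /= catA; apply: computes_cat cG (computes_cat cI cF).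
split; last split; last split.
- have [[pG [pGG sG]] [pI [pII sI]] [pF [pFF sF]]] :=
    factor_programs n_gt0 bijF0 cI0 bijG0.
  by exists (merge_program (pG ++ pI ++ pF)); apply: merged_program pFF sF.
- move=> k P F I G fact P_neq0.
  have [partP IE [bijG _] [bijF _]] := fact.
  have cI := factorisation_contraction fact P_neq0.
  have [] := factor_programs n_gt0 bijF cI bijG.
  by split=> // pG pI pF; apply: merged_program n_gt0 (factorisation_comp fact).
- by rewrite B_invE BE -!map_cat; apply: computes_routing.
(* Reversing the five sweeps exchanges [e] and [rev e], that is, [B_inv] and [B]. *)
- have := computes_multicast cE.
  by rewrite !rev_cat revK B_invE BE -!map_cat -!catA.
Qed.
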